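(* There exists an absolute constant $c>0$ such that the following holds for every integer $n\geq 1$: for any nonempty subset $A\subset \mathbb{F}_2^n$, writing $|A| = \alpha 2^{n}$, the set $A+A$ must contain a linear subspace $V$ of $\mathbb{F}_2^n$ of dimension $$\dim(V) \geq c\left(\frac{n}{\mathcal{L}(\alpha)^5}\right)^{1/2}-1.$$
   Context: For a positive real number $a$, $\mathcal{L}(a)$ denotes the least integer $m\ge 1$ such that $2^m a\ge 1$. Here $A+A=\{a+a' : a,a'\in A\}$ (with $a=a'$ allowed). *)

(* Defs.v *)
From HB Require Import structures.
From mathcomp Require Import all_boot all_order all_algebra.
From mathcomp Require Import boolp reals.

Set Implicit Arguments.
Unset Strict Implicit.
Unset Printing Implicit Defensive.

Import Order.TTheory GRing.Theory Num.Theory.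
Local Open Scope ring_scope.

Section CalL.
Context {R : realType}.
Implicit Types a : R.

Definition calL_pred a : pred nat := fun m => (1 <= m)%N && (1 <= 2 ^+ m * a).

(* The value 0 is only taken when no such m exists, that is, when a <= 0. *)
Definition calL a : nat :=
  if pselect (exists m, calL_pred a m) is left ex_m then ex_minn ex_m else 0%N.

Lemma calL_pred_ex a : 0 < a -> exists m, calL_pred a m.
Proof.
move=> a0; exists (Num.bound a^-1).+1; rewrite /calL_pred /=.
rewrite -ler_pdivrMr // div1r.
have := archi_boundP (ltW (etrans (invr_gt0 a) a0)).
move=> /ltW/le_trans; apply; rewrite -natrX ler_nat.
by rewrite (leq_trans (leqnSn _)) // ltnW // ltn_expl.
Qed.

Lemma calL_spec a : 0 < a ->
  [/\ (1 <= calL a)%N, 1 <= 2 ^+ calL a * a &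
      forall m, (1 <= m)%N -> 1 <= 2 ^+ m * a -> (calL a <= m)%N].
Proof.
move=> a0; rewrite /calL; case: pselect => [ex_m|]; last first.
  by move/(_ (calL_pred_ex a0)).
case: ex_minnP => m /andP[m1 ma] m_min; split=> // k k1 ka.
by apply: m_min; rewrite /calL_pred k1 ka.
Qed.

End CalL.

(* Main.v *)
Require Import Defs.
From HB Require Import structures.
From mathcomp Require Import all_boot all_order all_algebra.
From mathcomp Require Import boolp reals.
From mathcomp Require Import sequences exp.
From mathcomp Require Import zify ring lra.

(** Write N = 2^n, let A have density alpha >= 2^-L, and let
    F = N * (1_A * 1_A^-) / |A|^2 be its autocorrelation, normalised to have
    mean 1.  In characteristic 2, A + A = A - A is the support of F.  Fix a
    target dimension d.  The proof is a density increment driven by the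
    following dichotomy.

    If the complement of A - A has density less than 2^-d, a subspace of
    dimension d inside A - A is built greedily, one basis vector at a time:
    the forbidden choices never exhaust the space ([greedy_subspace]).

    Otherwise F - 1 equals -1 on a set of density at least 2^-d, so a moment of
    F - 1 of order comparable to d is not small.  All Fourier coefficients of
    F - 1 are nonnegative, hence so are all its moments, and therefore F itself
    has a large moment ([autocorr_moment]).  Averaging over the intersections of
    q ~ d random translates of A ([sifting]) then produces a set B of density
    2^-O(dL) almost all of whose differences lie in S = {F > 5/4}
    ([popular_differences]).  By the almost periodicity argument of Croot and
    Sisask, the average of 1_S over w + B - B barely changes when w is
    translated by t1 - t2 with t1, t2 in a set T of density 2^-O(d^2 L^4)
    ([many_almost_periods]).  Translating by k = 3L such differences
    damps every character outside the spectrum of T by 4^-k in all, which beats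
    the factor 1/alpha because the Fourier coefficients of F sum to 1/alpha
    ([iter_diff_mean_le_subspace]).  It matters here that the characters are
    cut off in the average of F, and not of 1_S: for the latter k would have
    to be of order dL.  By Chang's inequality the spectrum of T spans a space of
    dimension O(d^2 L^4) ([chang]), and on some coset of its annihilator A has
    density at least 17/16 * alpha ([density_increment]).

    As 2^-L <= alpha and no density exceeds 1, at most 16 L increments occur.
    They consume O(d^2 L^5) dimensions in total, so that a subspace of dimension
    d is found as soon as n is at least a constant times d^2 L^5. *)

Set Implicit Arguments.
Unset Strict Implicit.
Unset Printing Implicit Defensive.

Import Order.TTheory GRing.Theory Num.Theory.
Local Open Scope ring_scope.

(** * Averages over finite sets *)
Section Mean.
Variables (R : realType) (T : finType).
Implicit Types (A : {set T}) (f g : T -> R).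

Definition mean A f : R := (\sum_(x in A) f x) / #|A|%:R.

Lemma card_gt0R A : A != set0 -> 0 < #|A|%:R :> R.
Proof. by rewrite ltr0n card_gt0. Qed.

Lemma mean_const A c : A != set0 -> mean A (fun=> c) = c.
Proof.
move=> /card_gt0R A0; rewrite /mean sumr_const -[c *+ _]mulr_natr mulfK //.
by rewrite gt_eqF.
Qed.

Lemma eq_mean A f g : {in A, f =1 g} -> mean A f = mean A g.
Proof. by move=> fg; rewrite /mean (eq_bigr g). Qed.

Lemma ler_mean A f g : {in A, forall x, f x <= g x} -> mean A f <= mean A g.
Proof. by move=> fg; rewrite ler_wpM2r ?invr_ge0 ?ler0n// ler_sum. Qed.

Lemma meanB A f g : mean A (fun x => f x - g x) = mean A f - mean A g.
Proof. by rewrite /mean sumrB mulrBl. Qed.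

Lemma meanZ A c f : mean A (fun x => c * f x) = c * mean A f.
Proof. by rewrite /mean -mulr_sumr mulrA. Qed.

Lemma mean_sum (I : finType) A (F : I -> T -> R) :
  mean A (fun x => \sum_i F i x) = \sum_i mean A (F i).
Proof. by rewrite /mean exchange_big mulr_suml. Qed.

Lemma mean_ge0 A f : {in A, forall x, 0 <= f x} -> 0 <= mean A f.
Proof. by move=> f0; rewrite divr_ge0 ?sumr_ge0. Qed.

Lemma ler_norm_mean A f : `|mean A f| <= mean A (fun x => `|f x|).
Proof.
rewrite normrM normfV normr_nat ler_wpM2r ?invr_ge0 ?ler0n//.
exact: ler_norm_sum.
Qed.

Lemma mean_le_ex A f c : A != set0 -> c <= mean A f ->
  exists2 x, x \in A & c <= f x.
Proof.
move=> A0 cf; apply/exists_inP; apply: contraT => /exists_inPn fc.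
have /negP[] : ~~ (mean A f < c); first by rewrite -leNgt.
rewrite ltr_pdivrMr ?card_gt0R// mulr_natr -sumr_const.
have [a aA] := set0Pn _ A0.
by apply: ltr_sum => [|x /fc]; [apply/hasP; exists a; rewrite ?mem_index_enum|rewrite ltNge].
Qed.

End Mean.

Lemma mean_exchange (R : realType) (T U : finType) (A : {set T}) (B : {set U})
    (f : T -> U -> R) :
  mean A (fun x => mean B (f x)) = mean B (fun y => mean A (f ^~ y)).
Proof. by rewrite /mean -!mulr_suml exchange_big mulrAC. Qed.

(** * Exponential bounds for products *)
Section Exponential.
Variable R : realType.

(** Since exp(-w) >= 1 - w with w = y - 2y^2, it suffices that
    (1 + y)(1 - y + 2y^2) = 1 + y^2 (1 + 2y) is at least 1. *)
Lemma expR_le1D (y : R) : - 2^-1 <= y -> expR (y - 2 * y ^+ 2) <= 1 + y.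
Proof.
move=> y2.
have := expR_ge1Dx (- (y - 2 * y ^+ 2)).
rewrite expRN -lef_pV2 ?posrE ?invrK ?invr_gt0 ?expR_gt0//; last by nra.
move/le_trans; apply; rewrite -div1r ler_pdivrMr; last by nra.
suff : 0 <= y ^+ 2 * (1 + 2 * y) by lra.
by rewrite mulr_ge0 ?sqr_ge0//; lra.
Qed.

(** Products of this shape average to exactly 1 when the x_i are independent and
    centred.  This bound turns that identity into an exponential estimate on the
    sum of the x_i; it serves both for sampling and for Chang's inequality. *)
Lemma prod_ge_expR (I : finType) (l : R) (x : I -> R) :
  0 <= l <= 2^-1 -> (forall i, `|x i| <= 1) ->
  expR (l * \sum_i x i - 2 * l ^+ 2 * #|I|%:R) <= \prod_i (1 + l * x i).
Proof.
move=> /andP[l0 l1] x1.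
have -> : l * \sum_i x i - 2 * l ^+ 2 * #|I|%:R =
    \sum_i (l * x i - 2 * l ^+ 2).
  by rewrite sumrB sumr_const mulr_sumr mulr_natr.
rewrite expR_sum; apply: ler_prod => i _; rewrite expR_ge0/=.
have /ler_normlP[x1' x1''] := x1 i.
apply: le_trans (expR_le1D _); last by nra.
rewrite ler_expR lerD2l lerN2 ler_pM2l// exprMn ler_piMr ?sqr_ge0//.
by rewrite -real_normK ?num_real// expr_le1.
Qed.

Lemma expr2_le_expR n : 2 ^+ n <= expR n%:R :> R.
Proof.
rewrite -[n%:R]mulr1 expRM_natl.
by rewrite lerXn2r ?nnegrE ?expR_ge0//; have := expR_ge1Dx (1 : R).
Qed.

End Exponential.

(** * Random sampling and almost periods *)
Section Sampling.
Variable R : realType.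

(** The product of the 1 + l X(a_i) has mean 1 over A^m because X is centred on
    A, while it is at least exp(eta^2 m / 8) on the event being counted. *)
Lemma hoeffding_upper (T : finType) (A : {set T}) (X : T -> R) (m : nat)
    (eta : R) :
  0 <= eta <= 1 -> (forall x, `|X x| <= 1) -> \sum_(x in A) X x = 0 ->
  #|[set a : {ffun 'I_m -> T} in ffun_on (mem A) |
      eta * m%:R <= \sum_i X (a i)]|%:R * expR (eta ^+ 2 * m%:R / 8)
  <= #|A|%:R ^+ m.
Proof.
move=> /andP[eta0 eta1] X1 sumX.
(* This l maximises l eta - 2 l^2. *)
pose l := eta / 4.
have l01 : 0 <= l <= 2^-1 by rewrite /l; apply/andP; split; lra.
have -> : #|A|%:R ^+ m =
    \sum_(a : {ffun 'I_m -> T} | a \in ffun_on (mem A)) \prod_i (1 + l * X (a i)).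
  rewrite -(bigA_distr_big _ (fun=> fun x => 1 + l * X x)) prodr_const card_ord.
  by rewrite big_split/= -mulr_sumr sumX mulr0 addr0 sumr_const.
rewrite mulrC [_ * #|_|%:R]mulr_natr -sumr_const.
rewrite [leRHS](bigID (fun a : {ffun 'I_m -> T} => eta * m%:R <= \sum_i X (a i)))/=.
rewrite ler_wpDr//.
  apply: sumr_ge0 => a _; apply: prodr_ge0 => i _.
  have /ler_normlP[] := X1 (a i); case/andP: l01 => ? ? ? ?; nra.
rewrite [leLHS](eq_bigl (fun a : {ffun 'I_m -> T} => (a \in ffun_on (mem A)) &&
   (eta * m%:R <= \sum_i X (a i)))); last by move=> a; rewrite inE.
apply: ler_sum => a /andP[_ am].
apply: le_trans (prod_ge_expR l01 (fun i => X1 (a i))).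
rewrite ler_expR card_ord /l; have m0 : 0 <= m%:R :> R by [].
have := ler_wpM2l eta0 am.
lra.
Qed.

Lemma hoeffding (T : finType) (A : {set T}) (X : T -> R) (m : nat) (eta : R) :
  0 <= eta <= 1 -> (forall x, `|X x| <= 1) -> \sum_(x in A) X x = 0 ->
  #|[set a : {ffun 'I_m -> T} in ffun_on (mem A) |
      eta * m%:R <= `|\sum_i X (a i)| ]|%:R * expR (eta ^+ 2 * m%:R / 8)
  <= 2 * #|A|%:R ^+ m.
Proof.
move=> eta01 X1 sumX.
have U := hoeffding_upper m eta01 X1 sumX.
have NX1 x : `|- X x| <= 1 by rewrite normrN.
have NsumX : \sum_(x in A) - X x = 0 by rewrite sumrN sumX oppr0.
have {NX1 NsumX}L := hoeffding_upper m eta01 NX1 NsumX.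
apply: le_trans (_ : _ <= (_ + _) * _) _; last first.
  by rewrite mulrDl mulr2n mulrDl mul1r; apply: lerD; [exact: U|exact: L].
rewrite ler_pM2r ?expR_gt0// -natrD ler_nat.
apply: leq_trans (leq_card_setU _ _); apply/subset_leq_card/subsetP => a.
rewrite !inE => /andP[-> /=]; rewrite sumrN.
by rewrite ler_normr.
Qed.

Definition smooth (G : finZmodType) (A : {set G}) (f : G -> R) (x : G) : R :=
  mean A (fun a => f (x + a)).

(** Averaging over c, since every t satisfies c + (t, ..., t) \in B for exactly
    |B| values of c. *)
Lemma diagonal_pigeonhole (G : finZmodType) (m : nat) (B : {set {ffun 'I_m -> G}}) :
  exists c : {ffun 'I_m -> G},
    (#|B| * #|G| <= #|[set t | [ffun i => (c i + t)%R] \in B]| * #|G| ^ m)%N.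
Proof.
pose Tc (c : {ffun 'I_m -> G}) := [set t | [ffun i => (c i + t)%R] \in B].
have tot : (\sum_c #|Tc c| = #|B| * #|G|)%N.
  under eq_bigr do rewrite -sum1dep_card big_mkcond/=.
  rewrite exchange_big/= mulnC -sum_nat_const; apply: eq_bigr => t _.
  rewrite -big_mkcond/=.
  rewrite (reindex (fun c : {ffun 'I_m -> G} => [ffun i => (c i - t)%R]))/=.
    rewrite -sum1_card; apply: eq_bigl => c.
    by congr (_ \in B); apply/ffunP => i; rewrite !ffunE subrK.
  exists (fun c : {ffun 'I_m -> G} => [ffun i => (c i + t)%R]) => c _;
    by apply/ffunP => i; rewrite !ffunE ?subrK ?addrK.
apply/existsP; apply: contraT => /existsPn small.
have : (\sum_c (#|Tc c| * #|G| ^ m).+1 <= \sum_(c : {ffun 'I_m -> G}) #|B| * #|G|)%N.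
  by apply: leq_sum => c _; rewrite ltnNge; exact: small.
under eq_bigr do rewrite -addn1.
rewrite big_split/= -big_distrl/= tot sum1_card sum_nat_const card_ffun card_ord.
rewrite [X in (_ <= X)%N]mulnC -[X in (_ <= X)%N]addn0 leq_add2l leqn0 expn_eq0.
by rewrite -cardsT cards_eq0 => /andP[/eqP/setP/(_ 0)]; rewrite !inE.
Qed.

Lemma smooth_bounds (G : finZmodType) (A : {set G}) (f : G -> R) (x : G) :
  A != set0 -> (forall y, 0 <= f y <= 1) -> 0 <= smooth A f x <= 1.
Proof.
move=> A0 f01; apply/andP; split.
  by apply: mean_ge0 => a _; case/andP: (f01 (x + a)).
rewrite -(mean_const 1 A0); apply: ler_mean => a _.
by case/andP: (f01 (x + a)).
Qed.

(** Let h = smooth A f, and let c + (t, ..., t) range over tuples in A^m whose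
    empirical mean (1/m) sum_i f(x + a_i) is within eta of h(x) for all but
    theta |G| points x.  At least half of A^m is of this kind, so
    [diagonal_pigeonhole] provides one c that works for a dense set T of t.
    Translating the sample of c by t translates its empirical mean, so for t1 and
    t2 in T the values of h at x and at x + t1 - t2 are both compared with the
    empirical mean of c at x + t1. *)
Lemma croot_sisask (G : finZmodType) (A : {set G}) (f : G -> R) (m : nat)
    (eta theta : R) :
  A != set0 -> (0 < m)%N -> (forall x, 0 <= f x <= 1) -> 0 <= eta <= 1 ->
  4 <= theta * expR (eta ^+ 2 * m%:R / 8) ->
  exists2 T : {set G},
    #|A|%:R ^+ m * #|G|%:R <= 2 * #|T|%:R * #|G|%:R ^+ m :> R &
    {in T &, forall t1 t2,
      #|[set x | 2 * eta <= `|smooth A f (x + t1 - t2) - smooth A f x| ]|%:R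
      <= 2 * theta * #|G|%:R}.
Proof.
move=> A0 m0 f01 eta01; set e := expR _ => he.
have e0 : 0 < e by exact: expR_gt0.
have theta0 : 0 < theta by rewrite -(pmulr_lgt0 _ e0); lra.
have N0 : 0 < #|G|%:R :> R by rewrite ltr0n; apply/card_gt0P; exists 0.
have mR0 : 0 < m%:R :> R by rewrite ltr0n.
pose h := smooth A f.
pose X x a := f (x + a) - h x.
have X1 x a : `|X x a| <= 1.
  rewrite ler_norml /X; have := f01 (x + a); have := smooth_bounds x A0 f01.
  by rewrite -/(h x) => /andP[? ?] /andP[? ?]; apply/andP; split; lra.
have sumX x : \sum_(a in A) X x a = 0.
  rewrite sumrB sumr_const /h /smooth /mean -[_ *+ #|A|]mulr_natr divfK ?subrr//.
  by rewrite gt_eqF ?card_gt0R.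
pose bad (a : {ffun 'I_m -> G}) := [set x | eta * m%:R <= `|\sum_i X x (a i)|].
pose Am := [set a : {ffun 'I_m -> G} in ffun_on (mem A)].
have cardAm : #|Am| = (#|A| ^ m)%N by rewrite cardsE card_ffun_on card_ord.
have sumbad : \sum_(a in Am) #|bad a|%:R * e <= 2 * #|A|%:R ^+ m * #|G|%:R.
  have -> : \sum_(a in Am) #|bad a|%:R * e =
     \sum_x #|[set a : {ffun 'I_m -> G} in ffun_on (mem A) |
        eta * m%:R <= `|\sum_i X x (a i)| ]|%:R * e.
    rewrite -!mulr_suml -!natr_sum; congr (_%:R * _).
    under eq_bigr do rewrite -sum1dep_card big_mkcond/=.
    rewrite exchange_big/=; apply: eq_bigr => x _.
    rewrite -big_mkcondr/= -sum1_card; apply: eq_bigl => a.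
    by rewrite !inE.
  rewrite [leRHS](_ : _ = \sum_(x : G) 2 * #|A|%:R ^+ m); last first.
    by rewrite sumr_const [LHS]mulr_natr.
  apply: ler_sum => x _.
  exact: hoeffding.
pose B := [set a in Am | #|bad a|%:R <= theta * #|G|%:R].
have cardB : #|A|%:R ^+ m <= 2 * #|B|%:R :> R.
  pose B' := [set a in Am | ~~ (#|bad a|%:R <= theta * #|G|%:R)].
  have cB : #|B|%:R + #|B'|%:R = #|A|%:R ^+ m :> R.
    rewrite -natrX -cardAm -natrD; congr _%:R.
    rewrite -(cardsID [set a | #|bad a|%:R <= theta * #|G|%:R] Am).
    by congr addn; apply: eq_card => a; rewrite !inE // andbC.
  suff : #|B'|%:R * (theta * #|G|%:R) * e <= 2 * #|A|%:R ^+ m * #|G|%:R.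
    rewrite mulrA -[_ * _ * e]mulrAC ler_pM2r// => B'le.
    have : #|B'|%:R * 4 <= 2 * #|A|%:R ^+ m :> R.
      apply: le_trans B'le; rewrite -mulrA; exact: ler_wpM2l.
    lra.
  apply: le_trans sumbad; rewrite -mulr_suml ler_pM2r//.
  rewrite mulr_natl -sumr_const.
  rewrite [leRHS](bigID (mem B'))/= ler_wpDr ?sumr_ge0//.
  rewrite [leRHS](eq_bigl (mem B')); last first.
    by move=> a; rewrite !inE /= andbA andbb.
  by apply: ler_sum => a; rewrite !inE -ltNge => /andP[_ /ltW].
have [c hc] := diagonal_pigeonhole B.
pose T := [set t | [ffun i => (c i + t)%R] \in B].
exists T.
  rewrite -[2 * _]/(2 * #|T|%:R).
  have : #|B|%:R * #|G|%:R <= #|T|%:R * #|G|%:R ^+ m :> R.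
    by rewrite -natrX -!natrM ler_nat.
  have := ler_wpM2r (ltW N0) cardB; lra.
pose Tc t := [ffun i => (c i + t)%R] : {ffun 'I_m -> G}.
have Tbad t : t \in T -> #|bad (Tc t)|%:R <= theta * #|G|%:R.
  by rewrite !inE => /andP[].
have sumE t x : \sum_i X x (Tc t i) = \sum_i f (x + t + c i) - m%:R * h x.
  rewrite sumrB sumr_const card_ord [m%:R * _]mulr_natl; congr (_ - _).
  by apply: eq_bigr => i _; rewrite ffunE addrA addrAC.
move=> t1 t2 /Tbad b1 /Tbad b2.
have /subset_leq_card : [set x | 2 * eta <= `|h (x + t1 - t2) - h x|] \subset
   bad (Tc t1) :|: [set x | x + (t1 - t2) \in bad (Tc t2)].
  apply/subsetP => x; rewrite !inE; apply: contraTT.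
  rewrite negb_or -!ltNge !sumE addrA subrK => /andP[].
  rewrite !ltr_norml => /andP[p1 p2] /andP[p3 p4].
  apply/andP.
  split; rewrite -(ltr_pM2r mR0); lra.
move=> le1.
have {}le1 := leq_trans le1 (leq_card_setU _ _).
have cs : #|[set x | x + (t1 - t2) \in bad (Tc t2)]| = #|bad (Tc t2)|.
  rewrite -(card_preimset (bad (Tc t2)) (addIr (t1 - t2))).
  by apply: eq_card => x; rewrite !inE.
rewrite cs -(ler_nat R) natrD in le1.
by apply: le_trans le1 _; lra.
Qed.

End Sampling.

(** * Averages over difference sets and sifting *)
Section DifferenceAverages.
Variables (R : realType) (G : finZmodType).
Implicit Types (A B S T : {set G}) (f g : G -> R).

Definition diff_mean T f (u : G) : R :=
  mean T (fun t1 => mean T (fun t2 => f (u + t1 - t2))).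

(** Each application of [diff_mean T] costs at most kappa. *)
Lemma diff_mean_ge k T g (kappa : R) : T != set0 ->
  {in T &, forall t1 t2 u, g u - kappa <= g (u + t1 - t2)} ->
  forall u, g u - k%:R * kappa <= iter k (diff_mean T) g u.
Proof.
move=> T0 gT; elim: k => [|k IH] u; first by rewrite mul0r subr0.
rewrite iterS /diff_mean -[leLHS](mean_const _ T0).
apply: ler_mean => t1 t1T; rewrite -[leLHS](mean_const _ T0).
apply: ler_mean => t2 t2T; apply: le_trans (IH _).
have := gT _ _ t1T t2T u; rewrite -natr1 mulrDl mul1r; lra.
Qed.

Lemma ler_iter_diff_mean k T f g : (forall u, f u <= g u) ->
  forall u, iter k (diff_mean T) f u <= iter k (diff_mean T) g u.
Proof.
move=> fg; elim: k => [|k IH] u //=.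
by apply: ler_mean => t1 _; apply: ler_mean => t2 _; exact: IH.
Qed.

Lemma iter_diff_meanZ k T c f u :
  iter k (diff_mean T) (fun x => c * f x) u = c * iter k (diff_mean T) f u.
Proof.
elim: k u => [|k IH] u //=; rewrite /diff_mean -meanZ.
by apply: eq_mean => t1 _; rewrite -meanZ; apply: eq_mean => t2 _; exact: IH.
Qed.

(** Averaging the estimate of [croot_sisask] over a translate of - A replaces the
    exceptional set by its relative measure in A, which gives a bound valid at
    every point u. *)
Lemma diff_mean_almost_periodic A f (m : nat) (eta theta : R) :
  A != set0 -> (0 < m)%N -> (forall x, 0 <= f x <= 1) -> 0 <= eta <= 1 ->
  4 <= theta * expR (eta ^+ 2 * m%:R / 8) ->
  exists2 T : {set G},
    #|A|%:R ^+ m * #|G|%:R <= 2 * #|T|%:R * #|G|%:R ^+ m :> R &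
    {in T &, forall t1 t2 u,
      diff_mean A f u - (2 * eta + 2 * theta * #|G|%:R / #|A|%:R)
      <= diff_mean A f (u + t1 - t2)}.
Proof.
move=> A0 m0 f01 eta01 he.
have [T cT hT] := croot_sisask A0 m0 f01 eta01 he.
exists T => // t1 t2 t1T t2T u.
have dE w : diff_mean A f w = mean A (fun b => smooth A f (w - b)).
  rewrite /diff_mean mean_exchange; apply: eq_mean => b _.
  by apply: eq_mean => a _; rewrite addrAC.
have A0' : 0 < #|A|%:R :> R by exact: card_gt0R.
rewrite !dE lerBlDr -lerBlDl -meanB.
pose Z := [set x | 2 * eta <= `|smooth A f (x + t1 - t2) - smooth A f x| ].
apply: le_trans (_ : mean A (fun b => 2 * eta + (u - b \in Z)%:R) <= _).
  apply: ler_mean => b _.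
  have -> : u + t1 - t2 - b = u - b + t1 - t2 by rewrite -!addrA [- b + _]addrC -!addrA.
  rewrite inE; set d := smooth A f (u - b + t1 - t2).
  have /andP[d0 d1] := smooth_bounds (u - b + t1 - t2) A0 f01.
  have /andP[e0 e1] := smooth_bounds (u - b) A0 f01.
  case/andP: eta01 => eta0 _.
  rewrite -/d in d0 d1; case: (leP (2 * eta) `|_|) => [_|]; first by rewrite /=; lra.
  by rewrite ltr_norml => /andP[? ?] /=; lra.
rewrite /mean big_split/= sumr_const mulrDl -[_ *+ _]mulr_natr mulfK ?gt_eqF// lerD2l.
rewrite ler_pM2r ?invr_gt0//; apply: le_trans (hT _ _ t1T t2T).
rewrite -natr_sum ler_nat -sum1_card -/Z.
rewrite [leqRHS](reindex_inj (h := fun b => u - b)); last first.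
  by move=> b c /addrI /oppr_inj.
rewrite big_mkcond [leqRHS]big_mkcond/=; apply: leq_sum => b _.
by case: (b \in A); case: (_ \in Z).
Qed.

Definition rep A (x : G) : nat := #|[set y in A | y + x \in A]|.

Lemma repE A x : (rep A x)%:R = \sum_y (y \in A)%:R * (y + x \in A)%:R :> R.
Proof.
rewrite /rep -sum1_card natr_sum big_mkcond/=; apply: eq_bigr => y _.
by rewrite inE; case: (y \in A); case: (_ \in A); rewrite /= ?mulr0 ?mulr1.
Qed.

(** For a pair (u, v), the number of s for which both u and v lie in the
    intersection of the translates A - s_i is rep A (u - v) ^ q, because the q
    coordinates of s are chosen independently. *)
Lemma sifting_identity A (q : nat) (w : G -> R) :
  \sum_(s : {ffun 'I_q -> G})
     \sum_(u in [set u | [forall i, u + s i \in A]])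
     \sum_(v in [set u | [forall i, u + s i \in A]]) w (u - v)
  = #|G|%:R * \sum_x w x * (rep A x)%:R ^+ q.
Proof.
have inB (s : {ffun 'I_q -> G}) u :
    (u \in [set u | [forall i, u + s i \in A]])%:R
    = \prod_i (u + s i \in A)%:R :> R.
  rewrite inE; case: forallP => [uA|/forallP].
    by rewrite big1 // => i _; rewrite uA.
  by rewrite negb_forall => /existsP[i /negPf uA]; rewrite (bigD1 i)//= uA mul0r.
transitivity (\sum_u \sum_v w (u - v) * (rep A (u - v))%:R ^+ q).
  transitivity (\sum_u \sum_v \sum_(s : {ffun 'I_q -> G})
      w (u - v) * \prod_i ((u + s i \in A)%:R * (v + s i \in A)%:R)).
    under [RHS]eq_bigr do rewrite exchange_big/=.
    rewrite [RHS]exchange_big/=; apply: eq_bigr => s _.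
    rewrite big_mkcond/=; apply: eq_bigr => u _.
    rewrite -[LHS]mulrb -[LHS]mulr_natl [X in _ * X]big_mkcond inB mulr_sumr; apply: eq_bigr => v _.
    by rewrite -mulrb -[w _ *+ _]mulr_natl inB big_split/= mulrA mulrC.
  apply: eq_bigr => u _; apply: eq_bigr => v _; rewrite -mulr_sumr; congr (_ * _).
  rewrite -(bigA_distr_bigA (fun _ y => (u + y \in A)%:R * (v + y \in A)%:R)).
  rewrite prodr_const card_ord repE; congr (_ ^+ q).
  rewrite (reindex_inj (addrI (- v)))/=; apply: eq_bigr => y _.
  by rewrite [v + _]addrA subrr add0r mulrC addrA [u - v + y]addrC.
rewrite exchange_big/= mulr_natl -sumr_const; apply: eq_bigr => v _.
by rewrite (reindex_inj (addIr v))/=; apply: eq_bigr => u _; rewrite addrK.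
Qed.

(** Apply [sifting_identity] to the weight w = 1 - 1_{complement of S} / delta: some
    intersection B of translates has total weight at least the average.  This
    bounds |B| from below and the proportion of pairs with u - v outside S from
    above at the same time. *)
Lemma sifting A S (q : nat) (delta : R) : 0 < delta ->
  2 * \sum_(x | x \notin S) (rep A x)%:R ^+ q
    <= delta * \sum_x (rep A x)%:R ^+ q ->
  0 < \sum_x (rep A x)%:R ^+ q :> R ->
  exists B : {set G}, [/\ B != set0,
    #|G|%:R * \sum_x (rep A x)%:R ^+ q <= 2 * #|B|%:R ^+ 2 * #|G|%:R ^+ q :> R &
    1 - delta <= diff_mean B (fun x => (x \in S)%:R) 0].
Proof.
move=> d0; set Z' := \sum_(x | _) _; set Z := \sum_x _ => hS Z0.
have N0 : 0 < #|G|%:R :> R by rewrite ltr0n; apply/card_gt0P; exists 0.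
pose w x : R := 1 - (x \notin S)%:R / delta.
have := sifting_identity A q w.
have -> : \sum_x w x * (rep A x)%:R ^+ q = Z - Z' / delta.
  rewrite /Z' [in RHS]big_mkcond/= mulr_suml -sumrB; apply: eq_bigr => x _.
  by rewrite /w; case: (x \in S); rewrite /= ?mul0r ?subr0 ?mul1r// mulrBl !mul1r mulrC.
pose W (s : {ffun 'I_q -> G}) : R :=
  \sum_(u in [set u | [forall i, u + s i \in A]])
     \sum_(v in [set u | [forall i, u + s i \in A]]) w (u - v).
rewrite -[LHS]/(\sum_s W s) => sumW.
have hZ : Z / 2 <= Z - Z' / delta.
  rewrite -(ler_pM2r d0) mulrBl divfK ?gt_eqF//; lra.
have FT0 : [set: {ffun 'I_q -> G}] != set0 by apply/set0Pn; exists [ffun=> 0]; rewrite inE.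
have [|s _ hs] := mean_le_ex (c := #|G|%:R * (Z / 2) / #|G|%:R ^+ q) (f := W) FT0.
  rewrite /mean cardsT card_ffun card_ord natrX ler_pM2r ?invr_gt0 ?exprn_gt0//.
  rewrite (eq_bigl xpredT) ?sumW ?ler_pM2l// => s.
  by rewrite inE.
pose B := [set u | [forall i, u + s i \in A]].
have WE : W s = #|B|%:R ^+ 2 - (\sum_(u in B) \sum_(v in B) (u - v \notin S)%:R) / delta.
  rewrite /W -/B /w.
  under eq_bigr do rewrite sumrB sumr_const -mulr_suml.
  by rewrite sumrB sumr_const -mulr_suml -mulrnA natrM expr2.
set bad := \sum_(u in B) _ in WE.
have bad0 : 0 <= bad by rewrite /bad; do 2 apply: sumr_ge0 => ? _.
have hs' : #|G|%:R * (Z / 2) <= W s * #|G|%:R ^+ q.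
  by rewrite -ler_pdivrMr ?exprn_gt0.
have Ws0 : 0 < W s.
  rewrite -(pmulr_lgt0 _ (_ : 0 < #|G|%:R ^+ q)) ?exprn_gt0//.
  by apply: lt_le_trans hs'; rewrite mulr_gt0// divr_gt0.
have bd0 : 0 <= bad / delta by rewrite divr_ge0 // ltW.
have B0 : B != set0.
  apply/eqP => B0; move: Ws0; rewrite WE B0 cards0 expr0n/=; lra.
have cB : 0 < #|B|%:R :> R by exact: card_gt0R.
exists B; split => //.
  have : W s * #|G|%:R ^+ q <= #|B|%:R ^+ 2 * #|G|%:R ^+ q.
    by rewrite ler_pM2r ?exprn_gt0// WE; lra.
  lra.
have -> : diff_mean B (fun x => (x \in S)%:R) 0 = 1 - bad / #|B|%:R ^+ 2.
  have -> : bad = #|B|%:R ^+ 2 - \sum_(u in B) \sum_(v in B) (u - v \in S)%:R.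
    rewrite expr2 mulr_natr -sumr_const -sumrB; apply: eq_bigr => u _.
    rewrite -sumr_const -sumrB; apply: eq_bigr => v _.
    by case: (_ \in S); rewrite ?subrr ?subr0.
  rewrite mulrBl divff ?expf_neq0 ?gt_eqF// opprB addrC subrK.
  rewrite expr2 invfM mulrA /diff_mean /mean !mulr_suml; apply: eq_bigr => u _.
  by do 2 congr (_ / _); apply: eq_bigr => v _; rewrite add0r.
have : bad / delta <= #|B|%:R ^+ 2 by lra.
rewrite ler_pdivrMr// lerD2l lerN2 ler_pdivrMr ?exprn_gt0// mulrC //.
Qed.

End DifferenceAverages.

(** * Fourier analysis over the field with two elements *)
Section Fourier.
Variable R : realType.

Definition dotF2 n (x y : 'rV['F_2]_n) : 'F_2 := (x *m y^T) 0 0.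

Definition chi n (g x : 'rV['F_2]_n) : R := (-1) ^+ dotF2 g x.

Lemma signrF2D (a b : 'F_2) : (-1) ^+ (a + b)%R = (-1) ^+ a * (-1) ^+ b :> R.
Proof.
by case: a => [[|[|]]]//; case: b => [[|[|]]]//= *;
  rewrite ?expr0 ?expr1 ?mulr1 ?mul1r ?mulN1r ?opprK.
Qed.

Section Characters.
Variable n : nat.
Implicit Types (g x y : 'rV['F_2]_n) (A B T : {set 'rV['F_2]_n}).

Lemma chiC g x : chi g x = chi x g.
Proof. by rewrite /chi /dotF2 -[x *m _]trmxK trmx_mul trmxK [in RHS]mxE. Qed.

Lemma chiD g x y : chi g (x + y) = chi g x * chi g y.
Proof. by rewrite /chi /dotF2 linearD/= mulmxDr mxE signrF2D. Qed.

Lemma chi0r g : chi g 0 = 1.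
Proof. by rewrite /chi /dotF2 trmx0 mulmx0 mxE expr0. Qed.

Lemma chi0l x : chi 0 x = 1.
Proof. by rewrite chiC chi0r. Qed.

Lemma chi_sq g x : chi g x ^+ 2 = 1.
Proof. by rewrite /chi -exprM mulnC exprM sqrrN !expr1n. Qed.

Lemma chi_norm g x : `|chi g x| = 1.
Proof. exact: normr_sign. Qed.

Lemma chiB g x y : chi g (x - y) = chi g x * chi g y.
Proof.
by rewrite -[x in RHS](subrK y) [chi g (x - y + y)]chiD -mulrA -expr2 chi_sq mulr1.
Qed.

Lemma chi_neg1 g : g != 0 -> exists x, chi g x = -1.
Proof.
move=> /rV0Pn[i gi]; exists (delta_mx 0 i).
rewrite /chi; have -> : dotF2 g (delta_mx 0 i) = g 0 i.
  by rewrite /dotF2 trmx_delta -colE mxE.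
by move: gi; case: (g 0 i) => [[|[|]]].
Qed.

Lemma sum_chi g : \sum_x chi g x = (g == 0)%:R * #|'rV['F_2]_n|%:R.
Proof.
have [->|/chi_neg1[y gy]] := eqVneq g 0.
  by under eq_bigr do rewrite chi0l; rewrite sumr_const mul1r.
rewrite mul0r.
have : \sum_x chi g x = - \sum_x chi g x.
  rewrite {1}(reindex_inj (addIr y))/= -sumrN; apply: eq_bigr => x _.
  by rewrite chiD gy mulrN1.
lra.
Qed.

Lemma sum_chi_dual x : \sum_g chi g x = (x == 0)%:R * #|'rV['F_2]_n|%:R.
Proof. by rewrite -sum_chi; apply: eq_bigr => g _; rewrite chiC. Qed.

(** Positive definiteness, expressed on the Fourier side. *)
Definition posdef (f : 'rV['F_2]_n -> R) :=
  exists2 c : 'rV['F_2]_n -> R, (forall g, 0 <= c g) &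
    forall x, f x = \sum_g c g * chi g x.

Lemma posdef_ext f f' : f =1 f' -> posdef f -> posdef f'.
Proof. by move=> ff [c c0 fE]; exists c => // x; rewrite -ff. Qed.

Lemma posdefD f f' : posdef f -> posdef f' -> posdef (fun x => f x + f' x).
Proof.
move=> [c c0 fE] [c' c'0 fE']; exists (fun g => c g + c' g).
  by move=> g; rewrite addr_ge0.
by move=> x; rewrite fE fE' -big_split; apply: eq_bigr => g _; rewrite mulrDl.
Qed.

Lemma posdefM f f' : posdef f -> posdef f' -> posdef (fun x => f x * f' x).
Proof.
move=> [c c0 fE] [c' c'0 fE']; exists (fun g => \sum_h c h * c' (g - h)).
  by move=> g; apply: sumr_ge0 => h _; rewrite mulr_ge0.
move=> x; rewrite fE fE' mulr_suml.
under [RHS]eq_bigr do rewrite mulr_suml.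
rewrite [RHS]exchange_big/=; apply: eq_bigr => h _.
rewrite mulr_sumr (reindex_inj (addIr (- h)))/=; apply: eq_bigr => g _.
by rewrite [chi (g - h) x]chiC chiB !(chiC x) mulrACA; congr (_ * _);
  rewrite mulrCA -expr2 chi_sq mulr1.
Qed.

Lemma posdef_const (a : R) : 0 <= a -> posdef (fun=> a).
Proof.
move=> a0; exists (fun g => a * (g == 0)%:R); first by move=> g; rewrite mulr_ge0.
move=> x; rewrite (bigD1 0)//= eqxx chi0l !mulr1 big1 ?addr0// => g /negPf ->.
by rewrite mulr0 mul0r.
Qed.

Lemma posdefX f m : posdef f -> posdef (fun x => f x ^+ m).
Proof.
move=> pf; elim: m => [|m IH]; first exact: posdef_const ler01.
by apply: posdef_ext (posdefM pf IH) => x; rewrite exprS.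
Qed.

Lemma posdef_sum_ge0 f : posdef f -> 0 <= \sum_x f x.
Proof.
move=> [c c0 fE]; under eq_bigr do rewrite fE.
rewrite exchange_big/=; apply: sumr_ge0 => g _.
by rewrite -mulr_sumr mulr_ge0// sum_chi mulr_ge0.
Qed.

(** In the binomial expansion of the power of f + f', the term f' ^ m is only one
    of several positive definite terms. *)
Lemma posdef_exprD_sub f f' m : posdef f -> posdef f' ->
  posdef (fun x => (f x + f' x) ^+ m - f' x ^+ m).
Proof.
move=> pf pf'; elim: m => [|m IH].
  by apply: posdef_ext (posdef_const (lexx 0)) => x; rewrite !expr0 subrr.
apply: posdef_ext (posdefD (posdefM (posdefD pf pf') IH) (posdefM pf (posdefX m pf'))).
by move=> x; rewrite !exprS; ring.
Qed.

(** The convolution of the densities 1_A / alpha and 1_{-A} / alpha, of mean 1. *)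
Definition autocorr A x : R :=
  #|'rV['F_2]_n|%:R * (rep A x)%:R / #|A|%:R ^+ 2.

(** The Fourier coefficients are squares, hence nonnegative; every use of Fourier
    analysis below rests on this. *)
Lemma autocorr_fourier A x : A != set0 ->
  autocorr A x = \sum_g mean A (chi g) ^+ 2 * chi g x.
Proof.
move=> A0.
have -> : \sum_g mean A (chi g) ^+ 2 * chi g x =
   (\sum_g \sum_(a in A) \sum_(b in A) chi g (a + x - b)) / #|A|%:R ^+ 2.
  rewrite mulr_suml; apply: eq_bigr => g _.
  rewrite /mean exprMn exprVn mulrAC; congr (_ / _).
  rewrite expr2 -mulrA mulr_suml; apply: eq_bigr => a _.
  rewrite mulr_suml mulr_sumr; apply: eq_bigr => b _.
  by rewrite chiB chiD; ring.
congr (_ / _).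
rewrite repE mulr_sumr [RHS]exchange_big/= [RHS]big_mkcond/=; apply: eq_bigr => a _.
case: (a \in A); rewrite ?mul0r ?mulr0// mul1r exchange_big/=.
under eq_bigr do rewrite sum_chi_dual subr_eq0.
rewrite -mulr_suml mulrC; congr (_ * _).
have [axA|axA] := boolP (a + x \in A).
  by rewrite (bigD1 (a + x))//= eqxx big1 ?addr0// => b /andP[_ /negPf bn]; rewrite eq_sym bn.
rewrite big1 // => b bA; case: eqP => // axb; by rewrite axb bA in axA.
Qed.

Lemma card_rV_gt0 : 0 < #|'rV['F_2]_n|%:R :> R.
Proof. by rewrite ltr0n; apply/card_gt0P; exists 0. Qed.

Lemma autocorr_ge0 A x : 0 <= autocorr A x.
Proof. by rewrite /autocorr divr_ge0 ?mulr_ge0// exprn_ge0. Qed.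

Lemma mean_chi0 A : A != set0 -> mean A (chi 0) = 1.
Proof.
by move=> A0; rewrite -[RHS](mean_const 1 A0); apply: eq_mean => x _; rewrite chi0l.
Qed.

Lemma posdef_autocorr_sub1 A : A != set0 -> posdef (fun x => autocorr A x - 1).
Proof.
move=> A0; exists (fun g => if g == 0 then 0 else mean A (chi g) ^+ 2).
  by move=> g; case: eqP => // _; rewrite sqr_ge0.
move=> x; rewrite autocorr_fourier// (bigD1 0)//= [RHS](bigD1 0)//= eqxx mul0r add0r.
rewrite mean_chi0// expr1n chi0l mulr1 addrC addrK.
by apply: eq_bigr => g /negPf ->.
Qed.

(** Let f = autocorr A - 1, which is positive definite.  Then
    (1 + f)^2 = (1 + f^2) + 2f, and both summands are positive definite, so the
    sum of (1 + f)^(2p) is at least that of (2f)^p.  Now f = -1 wherever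
    rep A x = 0. *)
Lemma autocorr_moment A (p : nat) : A != set0 -> ~~ odd p ->
  2 ^+ p * #|[set x | rep A x == 0%N]|%:R <= \sum_x autocorr A x ^+ p.*2.
Proof.
move=> A0 p2; pose f x := autocorr A x - 1.
have pf : posdef f by exact: posdef_autocorr_sub1.
have pf1 : posdef (fun x => 1 + f x * f x).
  exact: posdefD (posdef_const ler01) (posdefM pf pf).
have pf2 : posdef (fun x => 2 * f x) by exact: posdefM (posdef_const (ler0n R 2)) pf.
have := posdef_sum_ge0 (posdef_exprD_sub p pf1 pf2).
rewrite sumrB subr_ge0 => le1.
apply: le_trans (le_trans le1 _); last first.
  apply: ler_sum => x _; rewrite -mul2n exprM.
  suff -> : 1 + f x * f x + 2 * f x = autocorr A x ^+ 2 by [].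
  by rewrite /f; ring.
under eq_bigr do rewrite exprMn.
rewrite -mulr_sumr ler_pM2l ?exprn_gt0//.
rewrite -sum1_card natr_sum big_mkcond/=; apply: ler_sum => x _.
rewrite inE; case: eqP => [r0|_]; last by rewrite exprn_even_ge0.
by rewrite /f /autocorr r0 mulr0 mul0r sub0r -signr_odd (negPf p2).
Qed.

Lemma chi_sum (r : nat) (J : {set 'I_r}) (g : 'I_r -> 'rV['F_2]_n) x :
  chi (\sum_(i in J) g i) x = \prod_(i in J) chi (g i) x.
Proof.
rewrite chiC (big_morph (chi x) (chiD x) (chi0r x)).
by apply: eq_bigr => i _; rewrite chiC.
Qed.

(** After expanding, each nonempty set of rows contributes a multiple of the sum of
    a nontrivial character, by linear independence of the rows. *)
Lemma riesz_product (r : nat) (M : 'M['F_2]_(r, n)) (e : 'I_r -> R) :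
  row_free M ->
  \sum_x \prod_i (1 + e i * chi (row i M) x) = #|'rV['F_2]_n|%:R.
Proof.
move=> freeM; under eq_bigr do under eq_bigr do rewrite addrC.
under eq_bigr do rewrite bigA_distr.
rewrite exchange_big/= (bigD1 set0)//= [X in _ + X]big1.
  rewrite addr0 (eq_bigr (fun=> 1)) ?sumr_const// => x _.
  by rewrite big1 // => i _; rewrite inE.
move=> J J0.
transitivity (\sum_x (\prod_(i in J) e i) * chi (\sum_(i in J) row i M) x).
  apply: eq_bigr => x _; rewrite -big_mkcond/= big_split/=.
  by rewrite chi_sum.
rewrite -mulr_sumr sum_chi.
have -> : \sum_(i in J) row i M = (\row_i (i \in J)%:R) *m M.
  rewrite mulmx_sum_row big_mkcond/=; apply: eq_bigr => i _.
  by rewrite mxE; case: (i \in J); rewrite ?scale1r ?scale0r.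
case: eqP => [/eqP|_]; last by rewrite mul0r mulr0.
rewrite mulmx_free_eq0// => /eqP/rowP J00; case/eqP: J0.
by apply/setP => i; have := J00 i; rewrite !mxE inE; case: (i \in J).
Qed.

End Characters.

(** Integrate the tangent line of exp at the mean of Y. *)
Lemma jensen_expR (T : finType) (A : {set T}) (Y : T -> R) : A != set0 ->
  expR (mean A Y) <= mean A (fun x => expR (Y x)).
Proof.
move=> A0; set m := mean A Y.
apply: le_trans (_ : mean A (fun x => expR m * (1 + (Y x - m))) <= _).
  rewrite meanZ -[leLHS]mulr1 ler_pM2l ?expR_gt0// /mean big_split/= mulrDl.
  rewrite -!/(mean _ _) mean_const// meanB mean_const// subrr addr0 //.
apply: ler_mean => x _.
have -> : expR (Y x) = expR m * expR (Y x - m) by rewrite -expRD addrC subrK.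
by rewrite ler_pM2l ?expR_gt0// expR_ge1Dx.
Qed.

(** Chang's inequality.  Compare the Riesz product over T with the Riesz product
    over the whole space.  The latter equals N; on T the exponent averages to at
    least (1/8)(r/2) - 2 r/64 = r/32, the signs e_i being those of the means of the
    characters over T. *)
Lemma chang n (T : {set 'rV['F_2]_n}) (r : nat) (M : 'M['F_2]_(r, n)) :
  T != set0 -> row_free M ->
  (forall i, 2^-1 <= `|mean T (chi (row i M))| :> R) ->
  expR (r%:R / 32) * #|T|%:R <= #|'rV['F_2]_n|%:R :> R.
Proof.
move=> T0 freeM hM.
pose e i : R := Num.sg (mean T (chi (row i M))).
pose Y x := 8^-1 * \sum_i e i * chi (row i M) x - 2 * 8^-1 ^+ 2 * #|'I_r|%:R.
have l01 : 0 <= (8^-1 : R) <= 2^-1 by apply/andP; split; lra.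
have e1 x i : `|e i * chi (row i M) x| <= 1.
  by rewrite normrM chi_norm mulr1 normr_sg lern1 leq_b1.
rewrite -(riesz_product (fun i => 8^-1 * e i) freeM).
apply: le_trans (_ : \sum_(x in T) expR (Y x) <= _); last first.
  rewrite big_mkcond; apply: ler_sum => x _.
  under eq_bigr do rewrite -mulrA.
  have le1 := prod_ge_expR l01 (e1 x).
  case: ifP => // _; apply: le_trans le1; exact: expR_ge0.
rewrite -ler_pdivlMr ?card_gt0R//; apply: le_trans (jensen_expR Y T0).
rewrite ler_expR /Y meanB mean_const// meanZ mean_sum card_ord.
have : \sum_(i < r) 2^-1 <= \sum_i mean T (fun x => e i * chi (row i M) x).
  by apply: ler_sum => i _; rewrite meanZ -normrEsg.
rewrite sumr_const card_ord -[_ *+ r]mulr_natr.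
lra.
Qed.

Section Spectrum.
Variable n : nat.
Implicit Types (g x y : 'rV['F_2]_n) (A B T : {set 'rV['F_2]_n}).

Lemma iter_diff_mean_fourier T (f c : 'rV['F_2]_n -> R) k :
  (forall x, f x = \sum_g c g * chi g x) ->
  forall x, iter k (diff_mean T) f x
    = \sum_g c g * (mean T (chi g) ^+ 2) ^+ k * chi g x.
Proof.
move=> fE; elim: k => [|k IH] x.
  by rewrite /= fE; apply: eq_bigr => g _; rewrite expr0 mulr1.
rewrite iterS /diff_mean.
transitivity (mean T (fun t1 => \sum_g
    (c g * (mean T (chi g) ^+ 2) ^+ k * chi g x * mean T (chi g)) * chi g t1)).
  apply: eq_mean => t1 _.
  transitivity (mean T (fun t2 => \sum_g
      (c g * (mean T (chi g) ^+ 2) ^+ k * chi g x * chi g t1) * chi g t2)).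
    by apply: eq_mean => t2 _; rewrite IH; apply: eq_bigr => g _; rewrite chiB chiD !mulrA.
  by rewrite mean_sum; apply: eq_bigr => g _; rewrite meanZ mulrAC.
rewrite mean_sum; apply: eq_bigr => g _; rewrite meanZ.
by rewrite [_ ^+ k.+1]exprS; ring.
Qed.

Lemma sum_mean_chi_sq A : A != set0 ->
  \sum_g mean A (chi g) ^+ 2 = #|'rV['F_2]_n|%:R / #|A|%:R.
Proof.
move=> A0; have := autocorr_fourier 0 A0.
under [X in _ = X -> _]eq_bigr do rewrite chi0r mulr1.
move=> <-; rewrite /autocorr.
have -> : rep A 0 = #|A|.
  by apply: eq_card => y; rewrite inE addr0 andbb.
by rewrite expr2 invfM mulrA mulfK // gt_eqF ?card_gt0R.
Qed.

(** Averaging over the row space of M projects onto the characters that are trivial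
    on it. *)
Lemma mean_chi_mulmx n' (M : 'M['F_2]_(n', n)) g :
  mean [set: 'rV['F_2]_n'] (fun y : 'rV['F_2]_n' => chi g (y *m M)) = (g *m M^T == 0)%:R.
Proof.
have chiM (y : 'rV['F_2]_n') : chi g (y *m M) = chi (g *m M^T) y.
  by rewrite /chi /dotF2 trmx_mul mulmxA.
rewrite /mean (eq_bigl xpredT); last by move=> y; rewrite inE.
under eq_bigr do rewrite chiM.
rewrite sum_chi cardsT mulfK// gt_eqF// ltr0n; apply/card_gt0P; by exists 0.
Qed.

(** M is a basis of the annihilator of the 1/2-spectrum of T.  A maximal linearly
    independent part of the spectrum has n - n' elements, to which [chang]
    applies. *)
Lemma spectral_subspace T : T != set0 ->
  exists n' (M : 'M['F_2]_(n', n)), [/\ row_free M, (n' <= n)%N,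
    forall g, 2^-1 <= `|mean T (chi g)| :> R -> g *m M^T = 0 &
    expR ((n - n')%:R / 32) * #|T|%:R <= #|'rV['F_2]_n|%:R :> R].
Proof.
move=> T0; pose Lam := [set g | 2^-1 <= `|mean T (chi g)| :> R].
pose Q : 'M['F_2]_(#|Lam|, n) := \matrix_i enum_val i.
have rowQ g : 2^-1 <= `|mean T (chi g)| :> R -> (g <= Q)%MS.
  move=> gL; have {}gL : g \in Lam by rewrite inE.
  have -> : g = row (enum_rank_in gL g) Q by rewrite rowK enum_rankK_in.
  exact: row_sub.
exists (\rank (kermx Q^T)), (row_base (kermx Q^T)).
have rk : \rank (kermx Q^T) = (n - \rank Q)%N by rewrite mxrank_ker mxrank_tr.
split.
- exact: row_base_free.
- by rewrite rk leq_subr.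
- move=> g /rowQ gQ.
  have : (row_base (kermx Q^T) *m Q^T = 0).
    by apply/eqP; rewrite -sub_kermx eq_row_base.
  move/(congr1 trmx); rewrite trmx_mul trmxK trmx0 => QM.
  have /submxP[D ->] := gQ.
  by rewrite -mulmxA QM mulmx0.
rewrite rk subKn ?rank_leq_col//.
apply: (chang (M := rowsub (maxrankfun Q) Q)) => //.
  exact: maxrowsub_free.
move=> i; rewrite row_rowsub rowK.
by have := enum_valP (maxrankfun Q i); rewrite inE.
Qed.

(** Compare the two sides one character at a time.  On the spectrum of T the
    average over the row space of M retains the whole coefficient.  Off it, the
    k applications of [diff_mean T] leave at most a fraction 4^-k, and the
    coefficients of the autocorrelation of A sum to N / |A|. *)
Lemma iter_diff_mean_le_subspace A B T (k n' : nat) (M : 'M['F_2]_(n', n)) :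
  A != set0 -> B != set0 -> T != set0 ->
  (forall g, 2^-1 <= `|mean T (chi g)| :> R -> g *m M^T = 0) ->
  iter k (diff_mean T) (diff_mean B (autocorr A)) 0
  <= mean [set: 'rV['F_2]_n'] (fun y : 'rV['F_2]_n' => diff_mean B (autocorr A) (y *m M))
     + 4^-1 ^+ k * (#|'rV['F_2]_n|%:R / #|A|%:R).
Proof.
move=> A0 B0 T0 TM.
pose c g : R := mean A (chi g) ^+ 2 * mean B (chi g) ^+ 2.
have PsiE x : diff_mean B (autocorr A) x = \sum_g c g * chi g x.
  have := iter_diff_mean_fourier B 1 (fun x => autocorr_fourier x A0) x.
  by rewrite /=; under eq_bigr do rewrite expr1.
have c0 g : 0 <= c g by rewrite mulr_ge0 ?sqr_ge0.
have mean1 X g : X != set0 -> mean X (chi g) ^+ 2 <= 1 :> R.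
  move=> X0; rewrite -real_normK ?num_real// expr_le1//.
  apply: le_trans (ler_norm_mean _ _) _; rewrite -[leRHS](mean_const 1 X0).
  by apply: ler_mean => x _; rewrite chi_norm.
have -> : mean [set: 'rV['F_2]_n'] (fun y : 'rV['F_2]_n' => diff_mean B (autocorr A) (y *m M))
    = \sum_g c g * (g *m M^T == 0)%:R.
  transitivity (mean [set: 'rV['F_2]_n'] (fun y : 'rV['F_2]_n' => \sum_g c g * chi g (y *m M))).
    by apply: eq_mean => y _.
  by rewrite mean_sum; apply: eq_bigr => g _; rewrite meanZ mean_chi_mulmx.
rewrite (iter_diff_mean_fourier T k PsiE) -sum_mean_chi_sq// mulr_sumr -big_split/=.
apply: ler_sum => g _; rewrite chi0r mulr1.
have cA : c g <= mean A (chi g) ^+ 2 by rewrite ler_piMr ?sqr_ge0 ?mean1.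
have [big|small] := leP 2^-1 (`|mean T (chi g)| : R).
  rewrite TM// eqxx mulr1 ler_wpDr//.
    by rewrite mulr_ge0 ?sqr_ge0// exprn_ge0// invr_ge0.
  by rewrite ler_piMr// exprn_ile1 ?sqr_ge0 ?mean1.
rewrite ler_wpDl//; first exact: mulr_ge0 (c0 g) (ler0n _ _).
rewrite [leLHS]mulrC; apply: ler_pM => //.
  by rewrite exprn_ge0 ?sqr_ge0.
rewrite lerXn2r ?nnegrE ?sqr_ge0 ?invr_ge0//.
rewrite -real_normK ?num_real//.
have := normr_ge0 (mean T (chi g) : R); nra.
Qed.

(** The average is itself an average, over b1, b2 in B and a in A, of the relative
    densities of A on the cosets a + b1 - b2 + (row space of M). *)
Lemma dense_coset A B (n' : nat) (M : 'M['F_2]_(n', n)) (c : R) :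
  A != set0 -> B != set0 ->
  c <= mean [set: 'rV['F_2]_n'] (fun y : 'rV['F_2]_n' => diff_mean B (autocorr A) (y *m M)) ->
  exists z, c * #|A|%:R * #|'rV['F_2]_n'|%:R
    <= #|[set y : 'rV['F_2]_n' | (y *m M + z)%R \in A]|%:R * #|'rV['F_2]_n|%:R.
Proof.
move=> A0 B0; rewrite mean_exchange => /(mean_le_ex B0)[b1 _].
rewrite mean_exchange => /(mean_le_ex B0)[b2 _].
have cA : 0 < #|A|%:R :> R by exact: card_gt0R.
set N := #|'rV['F_2]_n|%:R.
have autoE x : autocorr A x = mean A (fun a => N / #|A|%:R * (a + x \in A)%:R).
  rewrite meanZ /autocorr /mean -/N repE.
  have -> : \sum_y (y \in A)%:R * (y + x \in A)%:R = \sum_(y in A) (y + x \in A)%:R :> R.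
    by rewrite [RHS]big_mkcond; apply: eq_bigr => y _; case: (y \in A); rewrite ?mul1r ?mul0r.
  by rewrite expr2 invfM; ring.
rewrite (eq_mean (g := fun y : 'rV['F_2]_n' => mean A (fun a =>
   N / #|A|%:R * (a + (y *m M + b1 - b2) \in A)%:R))); last by move=> y _.
rewrite mean_exchange => /(mean_le_ex A0)[a _].
rewrite meanZ /mean cardsT => le1; exists (a + (b1 - b2)).
have n'0 : 0 < #|'rV['F_2]_n'|%:R :> R by rewrite ltr0n; apply/card_gt0P; exists 0.
have -> : #|[set y : 'rV['F_2]_n' | (y *m M + (a + (b1 - b2)))%R \in A]|%:R
   = \sum_(y in [set: 'rV['F_2]_n']) (a + (y *m M + b1 - b2) \in A)%:R :> R.
  rewrite -sum1_card natr_sum big_mkcond [RHS]big_mkcond/=; apply: eq_bigr => y _.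
  by rewrite !inE addrCA [y *m M + (b1 - b2)]addrA; case: (_ \in A).
move: le1; set s := \sum_(y in _) _ => le1.
have := ler_wpM2r (ltW (mulr_gt0 cA n'0)) le1.
rewrite -!mulrA => /le_trans; apply.
by rewrite [X in X <= _](_ : _ = s * N)//; field; rewrite !gt_eqF.
Qed.

End Spectrum.
End Fourier.

Arguments autocorr {R n} A x.

(** * The density increment *)
Section Increment.
Variables (R : realType) (n : nat).
Implicit Types (A B T : {set 'rV['F_2]_n}).

Local Notation N := (#|'rV['F_2]_n|%:R : R).

(** This numerical inequality dictates the order 40 d of the moment: passing from
    the norm of F to the threshold 5/4 must gain the constant 40 = 2 * 20 for
    every d >= 1. *)
Lemma threshold_power d : (0 < d)%N ->
  40 * (5 / 4) ^+ (40 * d) <= 2 ^+ (19 * d) :> R.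
Proof.
move=> d0; rewrite !exprM.
have q3 : (5 / 4) ^+ 3 <= 2 :> R by rewrite !exprS expr0; lra.
have q39 : (5 / 4) ^+ 39 <= 2 ^+ 13 :> R.
  by rewrite -[39%N]/(3 * 13)%N exprM lerXn2r ?nnegrE ?exprn_ge0 ?divr_ge0.
have q40 : 40 * (5 / 4) ^+ 40 <= 2 ^+ 19 :> R.
  rewrite [_ ^+ 40]exprS (_ : 2 ^+ 19 = 64 * 2 ^+ 13 :> R); last first.
    rewrite -[19%N]/(6 + 13)%N exprD; congr (_ * _); rewrite !exprS expr0; lra.
  have : 0 <= 2 ^+ 13 :> R by exact: exprn_ge0.
  move: q39; set a := _ ^+ 39; set b := _ ^+ 13; lra.
case: d d0 => // d _; elim: d => [|d IH]; first by rewrite !expr1.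
rewrite exprS [leRHS]exprS.
apply: le_trans (_ : (2 ^+ 19) * (40 * ((5 / 4) ^+ 40) ^+ d.+1) <= _).
  rewrite mulrCA ler_wpM2r ?mulr_ge0 ?exprn_ge0 ?divr_ge0//.
  apply: le_trans q40; rewrite ler_peMl ?exprn_ge0 ?divr_ge0// ler1n //.
by rewrite ler_wpM2l// exprn_ge0.
Qed.

(** Sifting with q = 40 d and S = {autocorr > 5/4}.  Points outside S contribute at
    most (5/4)^q N to the q-th moment, a negligible part by [threshold_power]. *)
Lemma popular_differences A (d L : nat) : A != set0 -> (0 < d)%N -> (0 < L)%N ->
  N <= 2 ^+ L * #|A|%:R ->
  N <= 2 ^+ d * #|[set x | rep A x == 0%N]|%:R ->
  exists B, [/\ B != set0, N <= 2 ^+ (41 * (d * L)) * #|B|%:R &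
    1 - 20^-1 <= diff_mean B (fun x => (x \in [set x | 5 / 4 < autocorr A x :> R])%:R : R) 0].
Proof.
move=> A0 d0 L0 hA hZ.
have N0 : 0 < N by exact: card_rV_gt0.
have a0 : 0 < #|A|%:R :> R by exact: card_gt0R.
pose q := (40 * d)%N; pose kap : R := #|A|%:R ^+ 2 / N.
have kap0 : 0 < kap by rewrite divr_gt0 ?exprn_gt0.
have repE' x : (rep A x)%:R = kap * autocorr A x.
  by rewrite /kap /autocorr; field; rewrite !gt_eqF.
have sumF : 2 ^+ (19 * d) * N <= \sum_x autocorr A x ^+ q.
  have := autocorr_moment R (p := 20 * d) A0; rewrite oddM/= => /(_ isT).
  rewrite -mul2n mulnA -/q; apply: le_trans.
  rewrite (_ : 20 * d = 19 * d + d)%N; last by rewrite -mulSnr.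
  by rewrite exprD -mulrA ler_wpM2l ?exprn_ge0.
have sumrep : \sum_x (rep A x)%:R ^+ q = kap ^+ q * \sum_x autocorr A x ^+ q :> R.
  by rewrite mulr_sumr; apply: eq_bigr => x _; rewrite repE' exprMn.
have sumF0 : 0 < \sum_x autocorr A x ^+ q :> R.
  by apply: lt_le_trans sumF; rewrite mulr_gt0// exprn_gt0.
have sumrep0 : 0 < \sum_x (rep A x)%:R ^+ q :> R.
  by rewrite sumrep mulr_gt0// exprn_gt0.
pose S := [set x | 5 / 4 < autocorr A x :> R].
have hS : 2 * \sum_(x | x \notin S) (rep A x)%:R ^+ q
    <= 20^-1 * \sum_x (rep A x)%:R ^+ q :> R.
  have : \sum_(x | x \notin S) (rep A x)%:R ^+ q <= kap ^+ q * ((5 / 4) ^+ q * N) :> R.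
    under eq_bigr do rewrite repE' exprMn.
    rewrite -mulr_sumr ler_wpM2l ?exprn_ge0 ?(ltW kap0)//.
    rewrite [leRHS](_ : _ = \sum_(x : 'rV['F_2]_n) (5 / 4) ^+ q); last first.
      by rewrite sumr_const [LHS]mulr_natr.
    rewrite big_mkcond/=; apply: ler_sum => x _.
    rewrite inE -leNgt; case: ifP => [le54|_]; last by rewrite exprn_ge0// divr_ge0.
    by rewrite lerXn2r ?nnegrE ?autocorr_ge0 ?divr_ge0.
  have thr := threshold_power d0.
  rewrite sumrep; move: sumF thr; rewrite -/q.
  have kq0 : 0 <= kap ^+ q by rewrite exprn_ge0 ?(ltW kap0).
  move=> sumF thr le1.
  have := ler_wpM2l kq0 (le_trans (ler_wpM2r (ltW N0) thr) sumF).
  lra.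
have d20 : 0 < (20^-1 : R) by rewrite invr_gt0.
have [B [B0 cB dB]] := sifting d20 hS sumrep0.
exists B; split => //.
have b0 : 0 < #|B|%:R :> R by exact: card_gt0R.
have kN0 : N * (kap ^+ q * N) <= 2 * #|B|%:R ^+ 2 * N ^+ q.
  apply: le_trans cB; rewrite ler_pM2l// sumrep ler_pM2l ?exprn_gt0//.
  by apply: le_trans sumF; rewrite ler_peMl ?(ltW N0)// exprn_ege1// ler1n.
have Nq : N ^+ 2 * #|A|%:R ^+ (2 * q) <= 2 * #|B|%:R ^+ 2 * N ^+ (2 * q).
  have -> : N ^+ 2 * #|A|%:R ^+ (2 * q) = N * (kap ^+ q * N) * N ^+ q.
    rewrite /kap exprMn exprVn -exprM; field.
    by rewrite expf_neq0 // gt_eqF.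
  rewrite [(2 * q)%N in leRHS]mul2n -addnn exprD [leRHS]mulrA ler_wpM2r ?exprn_ge0 ?(ltW N0)//.
have N2 : N ^+ 2 <= 2 ^+ (80 * (d * L) + 1) * #|B|%:R ^+ 2.
  rewrite -(ler_pM2r (_ : 0 < #|A|%:R ^+ (2 * q))) ?exprn_gt0//.
  apply: le_trans Nq _.
  have : N ^+ (2 * q) <= 2 ^+ (80 * (d * L)) * #|A|%:R ^+ (2 * q).
    have -> : (80 * (d * L) = L * (2 * q))%N by rewrite /q; clear; lia.
    by rewrite [2 ^+ (L * _)]exprM -exprMn lerXn2r ?nnegrE ?mulr_ge0 ?exprn_ge0 ?(ltW N0)//.
  rewrite addn1 [2 ^+ _.+1]exprS => le1.
  have b2 : 0 <= #|B|%:R ^+ 2 :> R by rewrite exprn_ge0.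
  have := ler_wpM2l b2 le1.
  move: (N ^+ (2 * q)) (2 ^+ (80 * (d * L))) (#|A|%:R ^+ (2 * q)) => X P Y; lra.
rewrite -(ler_sqr (ltW N0)) ?nnegrE ?mulr_ge0 ?exprn_ge0//.
apply: le_trans N2 _; rewrite exprMn -exprM ler_wpM2r ?exprn_ge0//.
rewrite ler_weXn2l ?ler1n//; have : (0 < d * L)%N by rewrite muln_gt0 d0 L0.
clear; lia.
Qed.

(** The accuracy 1 / (64 L) is what 3 L successive translations can afford.  It
    requires samples of size m of order D L^2, the factor D being needed to make
    the exceptional set small compared with B. *)
Lemma many_almost_periods B (f : 'rV['F_2]_n -> R) (D L : nat) :
  B != set0 -> (0 < L <= D)%N -> (forall x, 0 <= f x <= 1) ->
  N <= 2 ^+ (41 * D) * #|B|%:R ->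
  exists T, [/\ T != set0,
    N <= 2 ^+ (42 * (D * (2 ^ 25 * (D * L ^ 2)))) * #|T|%:R &
    {in T &, forall t1 t2 u,
      diff_mean B f u - (64 * L%:R)^-1 <= diff_mean B f (u + t1 - t2)}].
Proof.
move=> B0 /andP[L0 LD] f01 hB.
have N0 : 0 < N by exact: card_rV_gt0.
have b0 : 0 < #|B|%:R :> R by exact: card_gt0R.
have [m mE] : exists m, m = (2 ^ 25 * (D * L ^ 2))%N by exists (2 ^ 25 * (D * L ^ 2))%N.
rewrite -mE.
have l0 : 1 <= L%:R :> R by rewrite ler1n.
have l0' : L%:R != 0 :> R by rewrite pnatr_eq0 -lt0n.
have D0 : (0 < D)%N by exact: leq_trans LD.
have m0 : (0 < m)%N by rewrite mE muln_gt0 expn_gt0 muln_gt0 D0 expn_gt0 L0.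
pose eta : R := (2 ^+ 8 * L%:R)^-1.
have p8 : 2 ^+ 8 = 256 :> R by rewrite !exprS expr0; lra.
have eta0 : 0 < eta by rewrite invr_gt0 p8; lra.
have eta1 : eta <= 1 by rewrite /eta p8 invf_le1; lra.
(* With this choice, theta N / |B| is at most eta. *)
pose theta : R := eta / 2 ^+ (41 * D).
have he : 4 <= theta * expR (eta ^+ 2 * m%:R / 8).
  have -> : eta ^+ 2 * m%:R / 8 = (64 * D)%N%:R.
    have -> : m%:R = 2 ^+ 25 * D%:R * L%:R ^+ 2 :> R by rewrite mE natrM natrX natrM natrX mulrA.
    have -> : (64 * D)%N%:R = 64 * D%:R :> R by rewrite natrM.
    rewrite -[25%N]/(8 + (8 + 9))%N !exprD (_ : 2 ^+ 9 = 512); last by rewrite !exprS expr0; lra.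
    by rewrite /eta p8; field.
  apply: le_trans (ler_wpM2l _ (expr2_le_expR R _)); last first.
    by rewrite divr_ge0 ?exprn_ge0// ltW.
  have -> : theta * 2 ^+ (64 * D) = eta * 2 ^+ (23 * D).
    rewrite -[64%N]/(41 + 23)%N mulnDl exprD /theta mulrA divfK//.
    by rewrite expf_neq0// pnatr_eq0.
  rewrite /eta ler_pdivlMl; last by rewrite p8; lra.
  have L2D : L%:R <= 2 ^+ D :> R.
    by rewrite -natrX ler_nat (leq_trans LD)// ltnW// ltn_expl.
  have -> : (23 * D = D + 22 * D)%N by rewrite mulSn.
  have p22 : 1024 <= 2 ^+ (22 * D) :> R.
    rewrite -natrX -[1024]/((2 ^ 10)%N%:R) ler_nat leq_exp2l//.
    by rewrite (@leq_trans (22 * 1))// leq_mul2l.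
  rewrite p8 exprD; have := ler_pM _ _ L2D p22; rewrite !ler0n => /(_ isT isT).
  lra.
have eta01 : 0 <= eta <= 1 by rewrite (ltW eta0).
have [T cT perT] := diff_mean_almost_periodic B0 m0 f01 eta01 he.
have T0 : T != set0.
  apply/eqP => T0; move: cT; rewrite T0 cards0 mulr0 mul0r leNgt.
  by rewrite mulr_gt0// exprn_gt0.
exists T; split => //.
  have hBm : N ^+ m <= 2 ^+ (41 * (D * m)) * #|B|%:R ^+ m.
    by rewrite mulnA [2 ^+ _]exprM -exprMn lerXn2r ?nnegrE ?mulr_ge0 ?exprn_ge0 ?(ltW N0).
  have T2 : 0 <= 2 * #|T|%:R :> R by rewrite mulr_ge0.
  have : N <= 2 ^+ (41 * (D * m)).+1 * #|T|%:R.
    rewrite -(ler_pM2l (_ : 0 < #|B|%:R ^+ m)) ?exprn_gt0//.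
    apply: le_trans cT _; apply: le_trans (ler_wpM2l T2 hBm) _.
    rewrite [2 ^+ _.+1]exprS; move: (2 ^+ (41 * _)) (_ ^+ m) => P Q; lra.
  move/le_trans; apply; rewrite ler_wpM2r// ler_weXn2l ?ler1n//.
  have : (0 < D * m)%N by rewrite muln_gt0 D0 m0.
  by clear; lia.
move=> t1 t2 t1T t2T u; apply: le_trans (perT t1 t2 t1T t2T u).
rewrite lerD2l lerN2.
have : theta * N / #|B|%:R <= eta.
  rewrite ler_pdivrMr// /theta -mulrA ler_pM2l//.
  by rewrite ler_pdivrMl ?exprn_gt0.
have -> : (64 * L%:R)^-1 = 4 * eta by rewrite /eta p8; field.
lra.
Qed.

(** With g the average of 1_S over B - B, the steps of the argument read
    g >= 1 - 1/20 at 0, then 1 - 1/20 - 3/64 >= 9/10 after 3 L translations by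
    almost periods, then 5/4 * 9/10 = 9/8 for the autocorrelation in place
    of 1_S. *)
Lemma density_increment A (d L : nat) : A != set0 -> (0 < d)%N -> (0 < L)%N ->
  N <= 2 ^+ L * #|A|%:R ->
  N <= 2 ^+ d * #|[set x | rep A x == 0%N]|%:R ->
  exists n' (M : 'M['F_2]_(n', n)) z,
    [/\ row_free M, (n' <= n)%N, (n - n' <= 2 ^ 36 * (d ^ 2 * L ^ 4))%N &
      17 * #|A|%:R * #|'rV['F_2]_n'|%:R
      <= 16 * #|[set y : 'rV['F_2]_n' | (y *m M + z)%R \in A]|%:R * N].
Proof.
move=> A0 d0 L0 hA hZ.
have N0 : 0 < N by exact: card_rV_gt0.
have a0 : 0 < #|A|%:R :> R by exact: card_gt0R.
have [B [B0 cB popB]] := popular_differences A0 d0 L0 hA hZ.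
pose f x : R := (x \in [set x | 5 / 4 < autocorr A x :> R])%:R.
have f01 x : 0 <= f x <= 1 by rewrite /f; case: (x \in _); rewrite /= ?lexx ler01.
have LD : (0 < L <= d * L)%N by rewrite L0 leq_pmull.
have [T [T0 + perT]] := many_almost_periods B0 LD f01 cB.
have [m mE] : exists m, m = (d * L * (2 ^ 25 * (d * L * L ^ 2)))%N.
  by exists (d * L * (2 ^ 25 * (d * L * L ^ 2)))%N.
rewrite -mE => cT.
have [n' [M [freeM n'n specM rankM]]] := spectral_subspace R T0.
exists n', M.
have l0 : 1 <= L%:R :> R by rewrite ler1n.
have iterf : 9 / 10 <= iter (3 * L) (diff_mean T) (diff_mean B f) 0.
  apply: le_trans (diff_mean_ge (3 * L) T0 perT 0).
  rewrite -/f in popB.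
  have -> : (3 * L)%:R * (64 * L%:R)^-1 = 3 / 64 :> R.
    by rewrite natrM; field; rewrite pnatr_eq0 -lt0n.
  lra.
have iterF : 9 / 8 <= iter (3 * L) (diff_mean T) (diff_mean B (autocorr A)) 0 :> R.
  apply: le_trans (_ : iter (3 * L) (diff_mean T) (fun u => 5 / 4 * diff_mean B f u) 0 <= _).
    by rewrite iter_diff_meanZ; lra.
  apply: ler_iter_diff_mean => u; rewrite -(iter_diff_meanZ 1)/=.
  apply: (@ler_iter_diff_mean _ _ 1) => x; rewrite /f inE.
  case: ltP => [/ltW|_]; first by rewrite mulr1.
  by rewrite mulr0 autocorr_ge0.
(* 9/8 - 1/16 = 17/16, the 1/16 bounding the characters off the spectrum. *)
have dense : 17 / 16 <= mean [set: 'rV['F_2]_n']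
    (fun y : 'rV['F_2]_n' => diff_mean B (autocorr A) (y *m M)) :> R.
  have := le_trans iterF (iter_diff_mean_le_subspace (3 * L) A0 B0 T0 specM).
  suff : 4^-1 ^+ (3 * L) * (N / #|A|%:R) <= 16^-1 :> R by lra.
  apply: le_trans (_ : 4^-1 ^+ (3 * L) * 2 ^+ L <= _).
    by rewrite ler_wpM2l ?exprn_ge0 ?invr_ge0// ler_pdivrMr.
  rewrite exprM -exprMn.
  have -> : 4^-1 ^+ 3 * 2 = 32^-1 :> R by rewrite !exprS expr0; field.
  case: L L0 {hA cB LD perT iterf iterF mE popB l0} => // L _; rewrite exprS.
  have : 32^-1 ^+ L <= 1 :> R by rewrite exprn_ile1 ?invr_ge0 ?invf_le1 ?ler1n.
  lra.
have [z hz] := dense_coset A0 B0 dense.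
exists z; split => //; last by lra.
have t0 : 0 < #|T|%:R :> R by exact: card_gt0R.
have rle : (n - n' <= 32 * (42 * m))%N.
  rewrite -(leq_exp2l (m := 2))// -(ler_nat R) !natrX.
  apply: le_trans (expr2_le_expR R _) _.
  have -> : (n - n')%:R = 32%:R * ((n - n')%:R / 32) :> R by field.
  rewrite expRM_natl mulnC exprM lerXn2r ?nnegrE ?expR_ge0 ?exprn_ge0//.
  by rewrite -(ler_pM2r t0); exact: le_trans rankM cT.
apply: leq_trans rle _; rewrite mE.
rewrite -[36%N]/(11 + 25)%N expnD.
move: (2 ^ 25)%N => c.
have -> : (32 * (42 * (d * L * (c * (d * L * L ^ 2)))) = 1344 * c * (d ^ 2 * L ^ 4))%N.
  by ring.
by apply: leq_mul => //; apply: leq_mul.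
Qed.

End Increment.

(** * Subspaces of difference sets *)
Section Subspaces.

Lemma card_rVF2 k : #|'rV['F_2]_k| = (2 ^ k)%N.
Proof. by rewrite card_mx card_Fp// mul1n. Qed.

Lemma F2_eq0_or_eq1 (a : 'F_2) : a = 0 \/ a = 1.
Proof. by case: a => [[|[|//]] lt2]; [left|right]; exact: val_inj. Qed.

Lemma row_free_col_mx n i (M : 'M['F_2]_(i, n)) (v : 'rV['F_2]_n) :
  row_free M -> ~~ (v <= M)%MS -> row_free (col_mx v M).
Proof.
move=> freeM vM; apply/inj_row_free => y.
rewrite -[y]hsubmxK mul_row_col; move: (lsubmx y) (rsubmx y) => a b.
rewrite [a]mx11_scalar mul_scalar_mx; case: (F2_eq0_or_eq1 (a 0 0)) => ->.
  rewrite scale0r add0r; move/eqP; rewrite mulmx_free_eq0// => /eqP ->.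
  by rewrite (_ : 0%:M = 0) ?row_mx0//; apply/matrixP => ? ?; rewrite !mxE mul0rn.
rewrite scale1r; move/eqP; rewrite addr_eq0 => /eqP vE; case/negP: vM.
by rewrite vE -mulNmx submxMl.
Qed.

(** Given i < d independent rows whose span lies in S, a new row v fails only if
    it lies in the span or in some c - (span) with c outside S.  This excludes at
    most 2^i (1 + |~: S|) < 2^n vectors. *)
Lemma greedy_subspace n (S : {set 'rV['F_2]_n}) (d : nat) :
  0 \in S -> (d <= n)%N -> (2 ^ d * #|~: S| < 2 ^ n)%N ->
  exists2 M : 'M['F_2]_(d, n), row_free M & forall y, y *m M \in S.
Proof.
move=> S0 dn cS.
suff: forall i, (i <= d)%N ->
  exists2 M : 'M['F_2]_(i, n), row_free M & forall y, y *m M \in S by exact.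
elim => [_|i IH id].
  exists (0 : 'M_(0, n)); first by rewrite -row_leq_rank.
  by move=> y; rewrite mulmx0.
have [M freeM MS] := IH (ltnW id).
pose bad1 := [set y *m M | y : 'rV['F_2]_i].
pose bad2 := [set c - y *m M | c in ~: S, y in [set: 'rV['F_2]_i]].
have : (#|bad1 :|: bad2| < 2 ^ n)%N.
  apply: leq_ltn_trans (leq_card_setU _ _) _.
  have le1 : (#|bad1| <= 2 ^ i)%N.
    by rewrite -card_rVF2; exact: leq_imset_card.
  have le2 : (#|bad2| <= #|~: S| * 2 ^ i)%N.
    rewrite -card_rVF2 -cardsT /bad2 curry_imset2X.
    by apply: leq_trans (leq_imset_card _ _) _; rewrite cardsX.
  apply: leq_ltn_trans (leq_add le1 le2) _.
  rewrite -[X in (X + _)%N]mul1n -mulnDl.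
  have : (2 ^ i.+1 <= 2 ^ d)%N by rewrite leq_exp2l.
  have : (2 ^ d <= 2 ^ n)%N by rewrite leq_exp2l.
  rewrite expnS; move: cS; move: (2 ^ i)%N (2 ^ d)%N (2 ^ n)%N #|_| => I D E C.
  clear; nia.
rewrite -card_rVF2 => ltbad.
have /existsP[v vbad] : [exists v, v \notin bad1 :|: bad2].
  rewrite -negb_forall; apply/negP => /forallP all; move: ltbad.
  by rewrite ltnNge -cardsT subset_leq_card//; apply/subsetP => v _.
move: vbad; rewrite inE negb_or => /andP[vM vS].
exists (col_mx v M).
  apply: row_free_col_mx => //; apply: contra vM => /submxP[y ->].
  by apply/imsetP; exists y.
move=> y; rewrite -[y](@hsubmxK _ 1 1 i); move: (lsubmx _) (rsubmx _) => a b.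
suff : a *m v + b *m M \in S by rewrite -mul_row_col.
rewrite [a]mx11_scalar mul_scalar_mx; case: (F2_eq0_or_eq1 (a 0 0)) => ->.
  by rewrite scale0r add0r.
rewrite scale1r; apply: contraNT vS => vb; apply/imset2P; exists (v + b *m M) b; rewrite ?inE//.
by rewrite addrK.
Qed.

Variable R : realType.

Lemma rep_neq0 n (A : {set 'rV['F_2]_n}) x : rep A x != 0%N ->
  exists a b, [/\ a \in A, b \in A & x = a - b].
Proof.
rewrite -lt0n => /card_gt0P[y]; rewrite inE => /andP[yA yxA].
by exists (y + x), y; split=> //; rewrite addrC addKr.
Qed.

Lemma subspace_or_increment (d L n : nat) (A : {set 'rV['F_2]_n}) :
  (0 < d)%N -> (0 < L)%N -> A != set0 -> (2 ^ n <= 2 ^ L * #|A|)%N -> (d <= n)%N ->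
  (exists2 M : 'M['F_2]_(d, n), row_free M &
    forall y, exists a b, [/\ a \in A, b \in A & y *m M = a - b]) \/
  (exists n' (M : 'M['F_2]_(n', n)) z,
    [/\ row_free M, (n' <= n)%N, (n - n' <= 2 ^ 36 * (d ^ 2 * L ^ 4))%N &
      17 * #|A|%:R * 2 ^+ n'
      <= 16 * #|[set y : 'rV['F_2]_n' | (y *m M + z)%R \in A]|%:R * 2 ^+ n :> R]).
Proof.
move=> d0 L0 A0 hL dn; pose Z := [set x | rep A x == 0%N].
have [small|big] := ltnP (2 ^ d * #|Z|) (2 ^ n); [left|right].
  have CZ : ~: (~: Z) = Z by rewrite setCK.
  have [||M freeM MZ] := @greedy_subspace n (~: Z) d _ dn; last first.
  - by exists M => // y; apply: rep_neq0; have := MZ y; rewrite !inE.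
  - by rewrite CZ.
  rewrite !inE -lt0n; have [a aA] := set0Pn _ A0.
  by apply/card_gt0P; exists a; rewrite inE addr0 aA.
have hA : #|'rV['F_2]_n|%:R <= 2 ^+ L * #|A|%:R :> R.
  by rewrite card_rVF2 -natrX -natrM ler_nat.
have hZ : #|'rV['F_2]_n|%:R <= 2 ^+ d * #|Z|%:R :> R.
  by rewrite card_rVF2 -natrX -natrM ler_nat.
have [n' [M [z [freeM n'n cod dens]]]] := density_increment A0 d0 L0 hA hZ.
by exists n', M, z; split=> //; move: dens; rewrite !card_rVF2 !natrX.
Qed.

(** Induction on the number j of increments still possible: an increment replaces A
    by its trace on a coset, where the density is larger by 17/16, and
    translates of A have the same differences as A. *)
Lemma subspace_in_differences (d L : nat) : (0 < d)%N -> (0 < L)%N ->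
  forall (j n : nat) (A : {set 'rV['F_2]_n}), A != set0 ->
  (2 ^ n <= 2 ^ L * #|A|)%N -> (d + j * (2 ^ 36 * (d ^ 2 * L ^ 4)) <= n)%N ->
  16 ^+ j * 2 ^+ n <= 17 ^+ j * #|A|%:R :> R ->
  exists2 M : 'M['F_2]_(d, n), row_free M &
    forall y, exists a b, [/\ a \in A, b \in A & y *m M = a - b].
Proof.
move=> d0 L0; move: (2 ^ 36 * _)%N (@subspace_or_increment d L) => C step.
have p2 k : 0 < 2 ^+ k :> R by exact: exprn_gt0.
elim=> [|j IH] n A A0 hL hn hj.
all: have a0 : 0 < #|A|%:R :> R by exact: card_gt0R.
all: have [//|[n' [M [z [freeM n'n cod]]]]] := step n A d0 L0 A0 hL (leq_trans (leq_addr _ _) hn).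
all: set A' := [set y | _] => dens.
  (* No increment is possible from density 1. *)
  have A'n : #|A'|%:R <= 2 ^+ n' :> R by rewrite -natrX ler_nat -card_rVF2 max_card.
  move: hj; rewrite !expr0 !mul1r => hj.
  have := ler_pM _ _ A'n hj; rewrite ler0n ltW// => /(_ isT isT).
  have := mulr_gt0 a0 (p2 n'); lra.
have A'0 : A' != set0.
  apply/eqP => A'0; move: dens; rewrite A'0 cards0 mulr0 mul0r leNgt.
  by rewrite !mulr_gt0.
have hL' : (2 ^ n' <= 2 ^ L * #|A'|)%N.
  rewrite -(ler_nat R) natrM !natrX -(ler_pM2r (p2 n)).
  have : 2 ^+ n <= 2 ^+ L * #|A|%:R :> R by rewrite -!natrX -natrM ler_nat.
  move=> /(ler_wpM2r (ltW (p2 n'))); have := ler_wpM2l (ltW (p2 L)) dens.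
  have := mulr_gt0 (p2 n') (p2 n).
  move: (2 ^+ n') (2 ^+ n) (2 ^+ L) (#|A|%:R) (#|A'|%:R) => x y l a a'; lra.
have hn' : (d + j * C <= n')%N.
  move: hn cod n'n; clear; rewrite mulSn; move: (j * C)%N => c; lia.
have hj' : 16 ^+ j * 2 ^+ n' <= 17 ^+ j * #|A'|%:R :> R.
  rewrite -(ler_pM2r (p2 n)) -(ler_pM2l (_ : 0 < 16 :> R))//.
  have := ler_wpM2r (ltW (p2 n')) hj; rewrite !exprS.
  have q17 : 0 <= 17 ^+ j :> R by exact: exprn_ge0.
  have := ler_wpM2l q17 dens.
  move: (2 ^+ n') (2 ^+ n) (17 ^+ j) (16 ^+ j) (#|A|%:R) (#|A'|%:R) => x y s t a a'; lra.
have [M' freeM' M'A] := IH n' A' A'0 hL' hn' hj'.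
exists (M' *m M).
  by rewrite /row_free mxrankMfree.
move=> y; have [a [b [aA bA yM]]] := M'A y.
exists (a *m M + z), (b *m M + z); split; first by rewrite inE in aA.
  by rewrite inE in bA.
by rewrite mulmxA yM mulmxBl opprD addrACA subrr addr0.
Qed.

Lemma row_space_vspace d n (M : 'M['F_2]_(d, n)) : row_free M ->
  exists2 V : {vspace 'rV['F_2]_n}, \dim V = d & forall v, v \in V -> exists y, v = y *m M.
Proof.
move=> freeM; pose f := linfun (mulmxr M : 'rV['F_2]_d -> 'rV['F_2]_n).
exists (limg f); last by move=> v /memv_imgP[y _ ->]; exists y; rewrite lfunE.
rewrite limg_dim_eq ?dimvf ?/dim /= ?mul1n//.
apply/eqP; rewrite capfv -subv0; apply/subvP => y.
rewrite memv_ker lfunE/= mulmx_free_eq0// => /eqP ->; exact: mem0v.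
Qed.

Lemma oppv_F2 n (x : 'rV['F_2]_n) : - x = x.
Proof.
by apply/rowP => i; rewrite mxE; case: (F2_eq0_or_eq1 (x 0 i)) => ->; exact: val_inj.
Qed.

End Subspaces.

(** Sixteen increments double the density. *)
Lemma ratio_power (R : realFieldType) : 2 * 16 ^+ 16 <= 17 ^+ 16 :> R.
Proof.
have sq (u v a b : R) : 0 <= u -> 0 <= a -> v <= u ^+ 2 -> u * a <= b ->
    v * a ^+ 2 <= b ^+ 2.
  move=> u0 a0' uv ab; apply: le_trans (_ : (u * a) ^+ 2 <= _).
    by rewrite exprMn ler_wpM2r ?sqr_ge0.
  by rewrite lerXn2r ?nnegrE ?(le_trans _ ab)// mulr_ge0.
have s1 : 9 / 8 * 16 ^+ 2 <= 17 ^+ 2 :> R by rewrite !exprS expr0; lra.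
have s2 : 5 / 4 * 16 ^+ 4 <= 17 ^+ 4 :> R.
  rewrite ![_ ^+ 4](exprM _ 2 2); apply: sq s1; rewrite ?exprn_ge0 ?divr_ge0//.
  by rewrite !exprS expr0; lra.
have s3 : 3 / 2 * 16 ^+ 8 <= 17 ^+ 8 :> R.
  rewrite ![_ ^+ 8](exprM _ 4 2); apply: sq s2; rewrite ?exprn_ge0 ?divr_ge0//.
  by rewrite !exprS expr0; lra.
rewrite ![_ ^+ 16](exprM _ 8 2); apply: sq s3; rewrite ?exprn_ge0 ?divr_ge0//.
by rewrite !exprS expr0; lra.
Qed.

Theorem theorem1p3 (R : realType) :
  exists2 c : R, 0 < c &
    forall (n : nat) (A : {set 'rV['F_2]_n}),
      (1 <= n)%N -> A != set0 ->
      forall alpha : R, #|A|%:R = alpha * 2 ^+ n ->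
      exists2 V : {vspace 'rV['F_2]_n},
        {subset V <= [set x + y | x in A, y in A]} &
        c * Num.sqrt (n%:R / (calL alpha)%:R ^+ 5) - 1 <= (\dim V)%:R.
Proof.
(* c ^ 2 * 2 ^ 42 = 1, and 2 ^ 42 d ^ 2 L ^ 5 dominates the number
   d + 16 L * (2 ^ 36 d ^ 2 L ^ 4) of dimensions needed. *)
pose c : R := (2 ^+ 21)^-1.
have c0 : 0 < c by rewrite invr_gt0 exprn_gt0.
exists c => // n A n0 A0 alpha hA.
have p2n : 0 < 2 ^+ n :> R by exact: exprn_gt0.
have a0 : 0 < #|A|%:R :> R by exact: card_gt0R.
have alpha0 : 0 < alpha by rewrite -(pmulr_lgt0 _ p2n) -hA.
have [] := calL_spec alpha0; move: (calL alpha) => L L0 hL _.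
set x := c * _.
have x0 : 0 <= x by rewrite mulr_ge0 ?sqrtr_ge0 ?ltW.
pose d := Num.truncn x.
have /andP[dx xd] : d%:R <= x < d.+1%:R by exact: truncn_itv.
have [d0|d0] := posnP d.
  exists 0%VS.
    move=> v; rewrite memv0 => /eqP ->; have [a aA] := set0Pn _ A0.
    by apply/imset2P; exists a a => //; rewrite -{2}[a]oppv_F2 subrr.
  by move: xd; rewrite d0 dimv0 => xd; lra.
have l0 : 0 < L%:R ^+ 5 :> R by rewrite exprn_gt0// ltr0n.
have dn : (2 ^ 42 * (d ^ 2 * L ^ 5) <= n)%N.
  rewrite -(ler_nat R) natrM natrX natrM natrX (natrX _ L).
  have : d%:R ^+ 2 <= x ^+ 2 by rewrite lerXn2r ?nnegrE.
  rewrite /x exprMn sqr_sqrtr; last by rewrite divr_ge0 ?(ltW l0).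
  rewrite /c exprVn -exprM ler_pdivlMl ?exprn_gt0// ler_pdivlMr//.
  by rewrite -mulrA.
have hL' : (2 ^ n <= 2 ^ L * #|A|)%N.
  by rewrite -(ler_nat R) natrM !natrX hA mulrA ler_peMl ?(ltW p2n).
have hj : 16 ^+ (16 * L) * 2 ^+ n <= 17 ^+ (16 * L) * #|A|%:R :> R.
  have : 2 ^+ L * 16 ^+ (16 * L) <= 17 ^+ (16 * L) :> R.
    rewrite [16 ^+ _]exprM [17 ^+ _]exprM -exprMn.
    rewrite lerXn2r ?ratio_power// nnegrE; last exact: exprn_ge0 (ler0n R 17).
    exact: mulr_ge0 (ler0n R 2) (exprn_ge0 16 (ler0n R 16)).
  have : 2 ^+ n <= 2 ^+ L * #|A|%:R :> R.
    by rewrite -(natrX _ 2 n) -(natrX _ 2 L) -natrM ler_nat.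
  have p16 : 0 <= 16 ^+ (16 * L) :> R by exact: exprn_ge0 (ler0n R 16).
  move=> /(ler_wpM2l p16) le1 /(ler_wpM2r (ltW a0)) le2; apply: le_trans le1 _.
  by rewrite mulrA [_ * 2 ^+ L]mulrC.
have hn : (d + 16 * L * (2 ^ 36 * (d ^ 2 * L ^ 4)) <= n)%N.
  apply: leq_trans dn; rewrite -[42%N]/(6 + 36)%N expnD.
  have : (0 < 2 ^ 36)%N by rewrite expn_gt0.
  have : (d <= d ^ 2 * L ^ 5)%N.
    by rewrite expnS -mulnA leq_pmulr// muln_gt0 !expn_gt0 d0 L0.
  have -> : (d ^ 2 * L ^ 5 = L * (d ^ 2 * L ^ 4))%N by rewrite mulnCA expnS.
  move: (2 ^ 36)%N (d ^ 2 * L ^ 4)%N => C K; clear; nia.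
have [M freeM MA] := subspace_in_differences d0 L0 A0 hL' hn hj.
have [V dimV VM] := row_space_vspace freeM.
exists V; last by rewrite dimV; move: xd; rewrite -natr1; clear; lra.
move=> v /VM[y ->]; have [a [b [aA bA ->]]] := MA y.
by apply/imset2P; exists a b => //; rewrite oppv_F2.
Qed.
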